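(* Let $L(V)$ be the Kantor Lie-double of the Virasoro-like algebra, and let $\Delta_{\overline 0}(L(V))$ be the space of even $(-1)$-superderivations of $L(V)$. Then $\Delta_{\overline 0}(L(V))=\{0\}$.
   Context: For $\mathbf{m}=(m_1,m_2),\mathbf{n}=(n_1,n_2)\in\mathbb{Z}^2$ write $\det\binom{\mathbf{n}}{\mathbf{m}}=n_1m_2-n_2m_1$. The Kantor Lie-double $L(V)=L(V)_{\overline 0}\oplus L(V)_{\overline 1}$ of the Virasoro-like algebra is the complex Lie superalgebra whose even part $L(V)_{\overline 0}$ has basis $\{L_{\mathbf{m}}\mid\mathbf{m}\in\mathbb{Z}^2\setminus\{\mathbf{0}\}\}$, whose odd part $L(V)_{\overline 1}$ has basis $\{G_{\mathbf{m}}\mid\mathbf{m}\in\mathbb{Z}^2\setminus\{\mathbf{0}\}\}$, and whose bracket is $[L_{\mathbf{m}},L_{\mathbf{n}}]=\det\binom{\mathbf{n}}{\mathbf{m}}L_{\mathbf{m}+\mathbf{n}}$, $[L_{\mathbf{m}},G_{\mathbf{n}}]=\det\binom{\mathbf{n}}{\mathbf{m}}G_{\mathbf{m}+\mathbf{n}}=[G_{\mathbf{m}},L_{\mathbf{n}}]$, $[G_{\mathbf{m}},G_{\mathbf{n}}]=L_{\mathbf{m}+\mathbf{n}}$, with the convention $L_{\mathbf{0}}=0$, $G_{\mathbf{0}}=0$. For $\delta\in\mathbb{C}$, a $\delta$-superderivation of a Lie superalgebra $L$ is a homogeneous (with respect to the $\mathbb{Z}_2$-grading) linear map $D:L\to L$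 of degree $|D|$ with $D([x,y])=\delta([D(x),y]+(-1)^{|D||x|}[x,D(y)])$ for all homogeneous $x,y\in L$. It is even if $|D|=\overline 0$, i.e. $D(L_{\overline 0})\subseteq L_{\overline 0}$ and $D(L_{\overline 1})\subseteq L_{\overline 1}$. *)

(* Defs.v *)
From HB Require Import structures.
From mathcomp Require Import all_boot all_order all_algebra ring.
From mathcomp Require Import finmap monalg complex.
From mathcomp Require Import classical_sets reals.

Set Implicit Arguments.
Unset Strict Implicit.
Unset Printing Implicit Defensive.

Import GRing.Theory Num.Theory.

Local Open Scope ring_scope.
Local Open Scope classical_set_scope.

(* The group Z_2 of degrees is [bool], with [(+)] as addition and [&&] as
   multiplication: [homog false] is the even part, [homog true] the odd one. *)
Record lieSuperalgebra (K : numFieldType) := LieSuperalgebra {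
  carrier :> lmodType K;
  homog : bool -> set carrier;
  sbracket : carrier -> carrier -> carrier;
  homog0 : forall s, homog s 0;
  homogP : forall s (a : K) x y,
    homog s x -> homog s y -> homog s (a *: x + y);
  homog_sum : forall x,
    exists x0 x1, [/\ homog false x0, homog true x1 & x = x0 + x1];
  homog_direct : forall x, homog false x -> homog true x -> x = 0;
  sbracket_linear_r : forall x, linear (sbracket x);
  sbracket_linear_l : forall y, linear (sbracket ^~ y);
  sbracket_homog : forall s t x y,
    homog s x -> homog t y -> homog (s (+) t) (sbracket x y);
  sbracket_skew : forall s t x y, homog s x -> homog t y ->
    sbracket x y = - ((-1) ^+ (s && t) *: sbracket y x);
  sbracket_jacobi : forall s t u x y z,
    homog s x -> homog t y -> homog u z ->
    sbracket x (sbracket y z) =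
      sbracket (sbracket x y) z
      + (-1) ^+ (s && t) *: sbracket y (sbracket x z)
}.

Arguments homog {K} l _.
Arguments sbracket {K l} _ _.

Definition superderivation (K : numFieldType) (L : lieSuperalgebra K)
    (delta : K) (d : bool) : set (L -> L) :=
  [set D : L -> L | [/\ linear D,
    forall s x, homog L s x -> homog L (d (+) s) (D x) &
    forall s t x y, homog L s x -> homog L t y ->
      D (sbracket x y) =
        delta *: (sbracket (D x) y
                  + (-1) ^+ (d && s) *: sbracket x (D y))]].

Arguments superderivation {K} L delta d.

Definition even_superderivation (K : numFieldType) (L : lieSuperalgebra K)
    (delta : K) : set (L -> L) :=
  superderivation L delta false.

Arguments even_superderivation {K} L delta.

Section KantorDouble.
Context (K : numFieldType).

Definition lattice : choiceType := {m : int * int | m != 0}.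

(* The free module on Z_2 x (Z^2 \ {0}). *)
Definition kantor_carrier : lmodType K :=
  malg (bool * lattice)%type K.

(* [kvec false m] is L_m and [kvec true m] is G_m; both are 0 at m = 0. *)
Definition kvec (s : bool) (m : int * int) : kantor_carrier :=
  if insub m is Some k then mkmalgU (s, k) 1 else 0.

Definition detZ (n m : int * int) : K :=
  (n.1 * m.2 - n.2 * m.1)%:~R.

Definition kbracket_basis (s t : bool) (m n : int * int) : kantor_carrier :=
  match s, t with
  | false, false => detZ n m *: kvec false (m + n)
  | false, true | true, false => detZ n m *: kvec true (m + n)
  | true, true => kvec false (m + n)
  end.

Definition kbracket (x y : kantor_carrier) : kantor_carrier :=
  \sum_(k <- msupp x) \sum_(l <- msupp y)
    (mcoeff k x * mcoeff l y) *: kbracket_basis k.1 l.1 (val k.2) (val l.2).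

Definition khomog (s : bool) : set kantor_carrier :=
  [set x | forall k, k.1 != s -> mcoeff k x = 0].

Definition lext (T : choiceType) (W : lmodType K) (f : T -> W)
    (x : malg T K) : W :=
  \sum_(k <- msupp x) mcoeff k x *: f k.

Lemma lextEw (T : choiceType) (W : lmodType K) (f : T -> W)
    (x : malg T K) (d : {fset T}) :
  (msupp x `<=` d)%fset -> lext f x = \sum_(k <- d) mcoeff k x *: f k.
Proof.
move=> le; rewrite /lext (big_fset_incl _ le) // => k _ /mcoeff_outdom ->.
by rewrite scale0r.
Qed.

Lemma lext_linear (T : choiceType) (W : lmodType K) (f : T -> W) :
  linear (lext f).
Proof.
move=> a x y.
pose d := (msupp (a *: x + y) `|` (msupp x `|` msupp y))%fset.
rewrite (@lextEw _ _ f _ d) ?fsubsetUl // (@lextEw _ _ f x d); last first.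
  by rewrite /d fsetUCA fsubsetUl.
rewrite (@lextEw _ _ f y d); last by rewrite /d fsetUA fsubsetUr.
rewrite scaler_sumr -big_split /=; apply: eq_bigr => k _.
by rewrite mcoeffD mcoeffZ scalerDl scalerA.
Qed.

Lemma lextU (T : choiceType) (W : lmodType K) (f : T -> W) k :
  lext f (mkmalgU k 1) = f k.
Proof.
by rewrite /lext msuppU oner_eq0 big_seq_fset1 mcoeffUU scale1r.
Qed.

Lemma malg_lext (T : choiceType) (x : malg T K) :
  x = lext (fun k => mkmalgU k 1 : malg T K) x.
Proof.
rewrite {1}[x]monalgE; apply: eq_bigr => k _; apply/malgP => l.
by rewrite mcoeffZ !mcoeffU mulrnAr mulr1.
Qed.

Lemma linear_sum (U W : lmodType K) (f : U -> W) (I : Type) (r : seq I)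
    (c : I -> K) (F : I -> U) :
  linear f -> f (\sum_(i <- r) c i *: F i) = \sum_(i <- r) c i *: f (F i).
Proof.
move=> lf; elim: r => [|i r IH]; last by rewrite !big_cons lf IH.
by rewrite !big_nil; have := lf (-1) 0 0; rewrite scaler0 add0r scaleN1r addNr.
Qed.

Lemma kbracketE x y :
  kbracket x y = lext (fun k => lext (fun l =>
    kbracket_basis k.1 l.1 (val k.2) (val l.2)) y) x.
Proof.
apply: eq_bigr => k _; rewrite scaler_sumr; apply: eq_bigr => l _.
by rewrite scalerA.
Qed.

Lemma kbracket_linear_l y : linear (kbracket ^~ y).
Proof. by move=> a u v; rewrite /= !kbracketE lext_linear. Qed.

Lemma kbracket_linear_r x : linear (kbracket x).
Proof.
move=> a u v; rewrite !kbracketE /lext scaler_sumr -big_split /=.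
apply: eq_bigr => k _; rewrite -!/(lext _ _) lext_linear scalerDr.
by rewrite !scalerA mulrC.
Qed.

Lemma kvecE s (m : int * int) (m0 : m != 0) :
  kvec s m = mkmalgU (s, (Sub m m0 : lattice)) 1.
Proof. by rewrite /kvec insubT. Qed.

Lemma kvec0 s : kvec s 0 = 0.
Proof. by rewrite /kvec insubF // eqxx. Qed.

Lemma kvec_val s (k : lattice) : kvec s (val k) = mkmalgU (s, k) 1.
Proof. by rewrite /kvec valK. Qed.

Lemma kbracket0l y : kbracket 0 y = 0.
Proof. by rewrite /kbracket msupp0 big_seq_fset0. Qed.

Lemma kbracket0r x : kbracket x 0 = 0.
Proof. by rewrite /kbracket big1 // => k _; rewrite msupp0 big_seq_fset0. Qed.

Lemma kbracketZl a x y : kbracket (a *: x) y = a *: kbracket x y.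
Proof. by have := kbracket_linear_l y a x 0; rewrite /= addr0 kbracket0l addr0. Qed.

Lemma kbracketZr a x y : kbracket x (a *: y) = a *: kbracket x y.
Proof. by have := kbracket_linear_r x a y 0; rewrite /= addr0 kbracket0r addr0. Qed.

Lemma kbracket_kvec s t m n : m != 0 -> n != 0 ->
  kbracket (kvec s m) (kvec t n) = kbracket_basis s t m n.
Proof. by move=> m0 n0; rewrite !kvecE kbracketE !lextU. Qed.

Lemma detZ0l m : detZ 0 m = 0. Proof. by rewrite /detZ !mul0r subrr. Qed.
Lemma detZ0r m : detZ m 0 = 0. Proof. by rewrite /detZ !mulr0 subrr. Qed.

Lemma kbracket_LL m n :
  kbracket (kvec false m) (kvec false n) = detZ n m *: kvec false (m + n).
Proof.
have [->|m0] := eqVneq m 0; first by rewrite kvec0 kbracket0l detZ0r scale0r.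
have [->|n0] := eqVneq n 0; first by rewrite kvec0 kbracket0r detZ0l scale0r.
exact: kbracket_kvec.
Qed.

Lemma kbracket_LG m n :
  kbracket (kvec false m) (kvec true n) = detZ n m *: kvec true (m + n).
Proof.
have [->|m0] := eqVneq m 0; first by rewrite kvec0 kbracket0l detZ0r scale0r.
have [->|n0] := eqVneq n 0; first by rewrite kvec0 kbracket0r detZ0l scale0r.
exact: kbracket_kvec.
Qed.

Lemma kbracket_GL m n :
  kbracket (kvec true m) (kvec false n) = detZ n m *: kvec true (m + n).
Proof.
have [->|m0] := eqVneq m 0; first by rewrite kvec0 kbracket0l detZ0r scale0r.
have [->|n0] := eqVneq n 0; first by rewrite kvec0 kbracket0r detZ0l scale0r.
exact: kbracket_kvec.
Qed.

Lemma kbracket_GG m n : m != 0 -> n != 0 ->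
  kbracket (kvec true m) (kvec true n) = kvec false (m + n).
Proof. exact: kbracket_kvec. Qed.

Definition kcoef (s t : bool) (m n : int * int) : K :=
  if s && t then ((m != 0) && (n != 0))%:R else detZ n m.

Lemma kbracket_kcoef s t m n :
  kbracket (kvec s m) (kvec t n) = kcoef s t m n *: kvec (s (+) t) (m + n).
Proof.
case: s; case: t; rewrite /kcoef /= ?kbracket_LL ?kbracket_LG ?kbracket_GL //.
have [->|m0] := eqVneq m 0; first by rewrite kvec0 kbracket0l scale0r.
have [->|n0] := eqVneq n 0; first by rewrite kvec0 kbracket0r scale0r.
by rewrite kbracket_GG // scale1r.
Qed.

Lemma khomog0 s : khomog s 0.
Proof. by move=> k _; rewrite mcoeff0. Qed.

Lemma khomogP s (a : K) x y :
  khomog s x -> khomog s y -> khomog s (a *: x + y).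
Proof.
by move=> hx hy k ks; rewrite mcoeffD mcoeffZ hx // hy // mulr0 addr0.
Qed.

Lemma khomogZ s (a : K) x : khomog s x -> khomog s (a *: x).
Proof. by move=> hx; rewrite -[_ *: _]addr0; apply: khomogP => //; exact: khomog0. Qed.

Lemma khomog_bigsum s (I : eqType) (r : seq I) (F : I -> kantor_carrier) :
  (forall i, i \in r -> khomog s (F i)) -> khomog s (\sum_(i <- r) F i).
Proof.
move=> h; rewrite big_seq; apply: big_ind => //; first exact: khomog0.
by move=> x y hx hy; rewrite -[x]scale1r; apply: khomogP.
Qed.

Lemma khomog_kvec s m : khomog s (kvec s m).
Proof.
have [->|m0] := eqVneq m 0; first by rewrite kvec0; apply: khomog0.
rewrite kvecE => k ks; rewrite mcoeffU; case: eqP => // kE.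
by rewrite -kE eqxx in ks.
Qed.

Lemma khomog_supp s x k : khomog s x -> k \in msupp x -> k.1 = s.
Proof.
move=> hx; rewrite -mcoeff_neq0; apply: contraNeq => ks.
by rewrite hx.
Qed.

Lemma khomogE s x : khomog s x ->
  x = \sum_(k <- msupp x) mcoeff k x *: kvec s (val k.2).
Proof.
move=> hx; rewrite {1}[x]malg_lext; apply: eq_big_seq => k kx.
by rewrite kvec_val -(khomog_supp hx kx) -surjective_pairing.
Qed.

Lemma khomog_sum x :
  exists x0 x1, [/\ khomog false x0, khomog true x1 & x = x0 + x1].
Proof.
exists (\sum_(k <- msupp x | k.1 == false) mcoeff k x *: kvec k.1 (val k.2)).
exists (\sum_(k <- msupp x | k.1 != false) mcoeff k x *: kvec k.1 (val k.2)).
split.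
- rewrite -big_filter; apply: khomog_bigsum => k.
  by rewrite mem_filter => /andP[/eqP-> _]; exact/khomogZ/khomog_kvec.
- rewrite -big_filter; apply: khomog_bigsum => k.
  by rewrite mem_filter => /andP[]; case: k.1 => // _ _; exact/khomogZ/khomog_kvec.
- rewrite -(bigID (fun k => k.1 == false) predT) {1}[x]malg_lext; apply: eq_bigr => k _.
  by rewrite kvec_val -surjective_pairing.
Qed.

Lemma khomog_direct x : khomog false x -> khomog true x -> x = 0.
Proof.
move=> h0 h1; apply/malgP => k; rewrite mcoeff0.
by case E: k.1; [apply: h0 | apply: h1]; rewrite E.
Qed.

Lemma kbracket_homog s t x y :
  khomog s x -> khomog t y -> khomog (s (+) t) (kbracket x y).
Proof.
move=> hx hy; apply: khomog_bigsum => k kx; apply: khomog_bigsum => l ly.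
apply: khomogZ; rewrite (khomog_supp hx kx) (khomog_supp hy ly).
by case: s {hx} => /=; case: t {hy} => /=;
  do ?apply: khomogZ; exact: khomog_kvec.
Qed.

(* Linear maps that agree on the basis of a homogeneous part agree there. *)
Lemma khomog_ext s (W : lmodType K) (f g : kantor_carrier -> W) :
  linear f -> linear g ->
  (forall m, m != 0 -> f (kvec s m) = g (kvec s m)) ->
  forall x, khomog s x -> f x = g x.
Proof.
move=> lf lg fg x /khomogE ->; rewrite !linear_sum //.
by apply: eq_bigr => k _; rewrite fg // (valP k.2).
Qed.

Lemma linear_comp (U V W : lmodType K) (f : V -> W) (g : U -> V) :
  linear f -> linear g -> linear (fun x => f (g x)).
Proof. by move=> lf lg a x y; rewrite lg lf. Qed.

Lemma linear_scale (U V : lmodType K) (c : K) (f : U -> V) :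
  linear f -> linear (fun x => c *: f x).
Proof. by move=> lf a x y; rewrite lf scalerDr !scalerA mulrC. Qed.

Lemma linear_add (U V : lmodType K) (f g : U -> V) :
  linear f -> linear g -> linear (fun x => f x + g x).
Proof. by move=> lf lg a x y; rewrite lf lg scalerDr addrACA. Qed.

Lemma linear_opp (U V : lmodType K) (f : U -> V) :
  linear f -> linear (fun x => - f x).
Proof. by move=> lf a x y; rewrite lf opprD scalerN. Qed.

Lemma detZN m n : detZ m n = - detZ n m.
Proof. by rewrite /detZ -mulrNz; congr (_%:~R); ring. Qed.

Lemma kbracket_skew s t x y : khomog s x -> khomog t y ->
  kbracket x y = - ((-1) ^+ (s && t) *: kbracket y x).
Proof.
move=> hx hy; move: x hx; apply: khomog_ext.
- exact: kbracket_linear_l.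
- exact/linear_opp/linear_scale/kbracket_linear_r.
move=> m m0; move: y hy; apply: khomog_ext.
- exact: kbracket_linear_r.
- exact/linear_opp/linear_scale/kbracket_linear_l.
move=> n n0; rewrite !kbracket_kcoef scalerA -scaleNr [n + m]addrC addbC.
congr (_ *: _); rewrite /kcoef andbC; case: ifP => _.
  by rewrite m0 n0 expr1 mulN1r opprK.
by rewrite expr0 mul1r detZN.
Qed.

Lemma detZ_part m n : (m + n != 0)%:R * detZ n m = detZ n m.
Proof.
case: eqP => [/eqP|_]; last by rewrite mul1r.
rewrite addr_eq0 => /eqP ->; rewrite mul0r /detZ.
by rewrite (_ : _ - _ = 0) //= !mulrN [n.2 * _]mulrC subrr.
Qed.

Lemma kcoef_jacobi s t u k m n : k != 0 -> m != 0 -> n != 0 ->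
  kcoef t u m n * kcoef s (t (+) u) k (m + n) =
  kcoef s t k m * kcoef (s (+) t) u (k + m) n
  + (-1) ^+ (s && t) * (kcoef s u k n * kcoef t (s (+) u) m (k + n)).
Proof.
move=> k0 m0 n0; have E a b : (a + b != 0)%:R * detZ b a = detZ b a.
  exact: detZ_part.
case: s; case: t; case: u; rewrite /kcoef /= ?k0 ?m0 ?n0 /= ?andbT ?expr0 ?expr1
  ?mul1r ?mulr1 ?[_ * (_ + _ != 0)%:R]mulrC ?E /detZ;
  rewrite -?mulrNz -?intrM -?intrD -?intrN ?mulN1r -?intrN -?intrD;
  congr (_%:~R); rewrite /=; ring.
Qed.

Lemma kbracket_jacobi s t u x y z :
  khomog s x -> khomog t y -> khomog u z ->
  kbracket x (kbracket y z) =
    kbracket (kbracket x y) z + (-1) ^+ (s && t) *: kbracket y (kbracket x z).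
Proof.
move=> hx hy hz; move: x hx; apply: khomog_ext.
- exact: kbracket_linear_l.
- apply: linear_add; last apply: linear_scale.
    exact: (linear_comp (kbracket_linear_l z) (kbracket_linear_l y)).
  exact: (linear_comp (kbracket_linear_r y) (kbracket_linear_l z)).
move=> k k0; move: y hy; apply: khomog_ext.
- exact: (linear_comp (kbracket_linear_r _) (kbracket_linear_l z)).
- apply: linear_add; last apply: linear_scale.
    exact: (linear_comp (kbracket_linear_l z) (kbracket_linear_r _)).
  exact: kbracket_linear_l.
move=> m m0; move: z hz; apply: khomog_ext.
- exact: (linear_comp (kbracket_linear_r _) (kbracket_linear_r _)).
- apply: linear_add; last apply: linear_scale.
    exact: kbracket_linear_r.
  exact: (linear_comp (kbracket_linear_r _) (kbracket_linear_r _)).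
move=> n n0.
rewrite !(kbracket_kcoef, kbracketZl, kbracketZr) !scalerA.
rewrite -!addbA [t (+) (s (+) u)]addbCA !addrA [m + k]addrC -scalerDl.
by congr (_ *: _); rewrite kcoef_jacobi // !mulrA.
Qed.

(* The basis relations are [kbracket_LL], [kbracket_LG], [kbracket_GL] and
   [kbracket_GG]. *)
Definition kantor_virasoro : lieSuperalgebra K :=
  LieSuperalgebra khomog0 khomogP khomog_sum khomog_direct
    kbracket_linear_r kbracket_linear_l kbracket_homog
    kbracket_skew kbracket_jacobi.

End KantorDouble.

(* Main.v *)
(** Comparing coefficients splits an even (-1)-superderivation D into its
    homogeneous parts of degree k in Z^2, each satisfying the defining identity
    separately: D L_m = f(m) L_(m+k) and D G_m = g(m) G_(m+k).  On the even part,
    with det(k,m) <> 0, the pairs (m,-m), (m,2m), (m,m+k) and (-m,-m-k) give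
    f(-m) = -f(m), f(2m) = 2 f(m), f(2m+k) = -2 f(m+k) and f(2m+k) = -2 f(m).
    Hence f(m+k) = f(m), so 2 f(m) = f(2m) = f(2m+k) = -2 f(m) and f(m) = 0; the
    m parallel to k <> 0 follow by writing L_m as a bracket.  For k = 0,
    f(m+n) = - f(m) - f(n) whenever det(n,m) <> 0, which forces f(m) = f(m+n),
    and then 3 f = 0.  On the odd part, [G_m,G_n] = L_(m+n) then gives
    g(m) + g(n) = 0, hence g = 0. *)
Require Import Defs.
From mathcomp Require Import all_boot all_order all_algebra ring lra.
From mathcomp Require Import finmap monalg complex boolp classical_sets reals.

Set Implicit Arguments.
Unset Strict Implicit.

Import Order.TTheory GRing.Theory Num.Theory.
Local Open Scope ring_scope.
Local Open Scope classical_set_scope.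

(** * The determinant form on the lattice *)

Section Determinant.
Context {K : numFieldType}.
Implicit Types m n p : int * int.
Local Notation det := (@Defs.detZ K).

Lemma detZDl m n p : det (m + n) p = det m p + det n p.
Proof. by rewrite /Defs.detZ -intrD; congr (_%:~R) => /=; ring. Qed.

Lemma detZDr m n p : det p (m + n) = det p m + det p n.
Proof. by rewrite /Defs.detZ -intrD; congr (_%:~R) => /=; ring. Qed.

Lemma detZNl m n : det (- m) n = - det m n.
Proof. by rewrite /Defs.detZ -mulrNz; congr (_%:~R) => /=; ring. Qed.

Lemma detZNr m n : det m (- n) = - det m n.
Proof. by rewrite /Defs.detZ -mulrNz; congr (_%:~R) => /=; ring. Qed.

Lemma detZnn m : det m m = 0.
Proof. by rewrite /Defs.detZ (_ : _ - _ = 0) //; ring. Qed.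

(** A quarter turn: [det n (rot90 m)] is the scalar product of [n] and [m], so for [m != 0] this is
    a vector not parallel to [m]. *)
Definition rot90 m : int * int := (- m.2, m.1).

Lemma detZ_rot90 m : m != 0 -> det m (rot90 m) != 0.
Proof.
rewrite /Defs.detZ intr_eq0 /=; apply: contraNneq; case: m => a b /= h.
by apply/eqP; congr pair; nra.
Qed.

Lemma detZ_rot90_parallel m n : m != 0 -> n != 0 -> det m n = 0 ->
  det n (rot90 m) != 0.
Proof.
move=> m0 n0 /eqP; rewrite /Defs.detZ !intr_eq0 /= => /eqP.
case: m m0 => a b; case: n n0 => c d /= n0 m0 h.
(* Lagrange's identity: scalar product and determinant cannot both vanish on nonzero vectors. *)
apply/eqP => h'; have : (a ^+ 2 + b ^+ 2) * (c ^+ 2 + d ^+ 2) = 0.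
  transitivity ((c * a - d * - b) ^+ 2 + (a * d - b * c) ^+ 2); first ring.
  by rewrite h h' expr0n addr0.
move/eqP; rewrite mulf_eq0 => /orP[] /eqP e.
  by move/eqP: m0; apply; congr pair; nra.
by move/eqP: n0; apply; congr pair; nra.
Qed.

Lemma lattice_mulrn_eq0 m j : (m *+ j.+1 == 0) = (m == 0).
Proof.
apply/eqP/eqP => [|->]; last by rewrite mul0rn.
case: m => a b; rewrite (_ : (a, b) *+ j.+1 = (a *+ j.+1, b *+ j.+1)).
  by case=> /eqP; rewrite mulrn_eq0 /= => /eqP -> /eqP; rewrite mulrn_eq0 /= => /eqP ->.
by elim: j => [|j IH] //; rewrite !(mulrS _ j.+1) IH.
Qed.

(** Discharges side conditions such as [m + n + k != 0] by exhibiting a nonzero determinant. *)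
Lemma detZ_neq0l m n : det m n != 0 -> m != 0.
Proof. by apply: contraNneq => ->; rewrite detZ0l. Qed.

End Determinant.

(** Shaped for [ring]: the last premise says that a known equation [u = v] is [c] times the wanted
    one. *)
Lemma eq_cancel (K : idomainType) (c u v x y : K) :
  c != 0 -> u = v -> c * (x - y) = u - v -> x = y.
Proof.
by move=> c0 ->; rewrite subrr => /eqP; rewrite mulf_eq0 (negPf c0) subr_eq0 => /eqP.
Qed.

(** * The functional equation on the even part *)

Section EvenPart.
Context {K : numFieldType} (k : int * int) (f : int * int -> K).
Local Notation det := (@Defs.detZ K).
Hypothesis fE : forall m n, m + n + k != 0 ->
  det n m * f (m + n) = - (det n (m + k) * f m + det (n + k) m * f n).

Let two_neq0 : (2%:R : K) != 0. Proof. by rewrite pnatr_eq0. Qed.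

Lemma degree0_vanish m : k = 0 -> m != 0 -> f m = 0.
Proof.
move=> k0 m0.
have add a b : det b a != 0 -> f (a + b) = - (f a + f b).
  move=> ba; apply: (mulfI ba).
  have := @fE a b; rewrite k0 !addr0 => ->; first by ring.
  apply: contraNneq ba => /eqP; rewrite addr_eq0 => /eqP ->.
  by rewrite detZNr detZnn oppr0.
(* Compute f(a+2b) in two ways, as (a+b)+b and as a+(b+b). *)
have dbl a b : det b a != 0 -> f (b + b) = - (f a + f a).
  move=> ba; have e1 := add _ _ ba.
  have e2 : f (a + b + b) = - (f (a + b) + f b).
    by apply: add; rewrite detZDr detZnn addr0.
  have e3 : f (a + (b + b)) = - (f a + f (b + b)).
    by apply: add; rewrite detZDl -mulr2n mulrn_eq0.
  move: e3; rewrite addrA e2 e1 => e3.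
  by apply: eq_cancel (oner_neq0 K) e3 _; ring.
(* The left side of [dbl] does not involve a, so a may be replaced by a+b. *)
have shift a b : det b a != 0 -> f a = f (a + b).
  move=> ba; apply: (mulfI two_neq0).
  have e := dbl _ _ ba.
  have e' : f (b + b) = - (f (a + b) + f (a + b)).
    by apply: dbl; rewrite detZDr detZnn addr0.
  by rewrite !mulr_natl !mulr2n; apply: oppr_inj; rewrite -e.
pose n := rot90 m; have nm : det n m != 0 by rewrite detZN oppr_eq0 detZ_rot90.
have e1 := shift _ _ nm.
have e2 : f n = f (n + m) by apply: shift; rewrite detZN oppr_eq0.
have e3 := add _ _ nm.
rewrite e2 [n + m]addrC -!e1 in e3.
have c0 : 3%:R != 0 :> K by rewrite pnatr_eq0.
by apply: eq_cancel c0 e3 _; ring.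
Qed.

Lemma nonparallel_vanish m : det k m != 0 -> f m = 0.
Proof.
have opp a : det k a != 0 -> f (- a) = - f a.
  move=> ka; have := @fE a (- a); rewrite subrr add0r => /(_ (detZ_neq0l ka)).
  rewrite !detZDl !detZDr !detZNl detZnn [det a k]detZN => e.
  by apply: eq_cancel ka e _; ring.
have dbl a : det k a != 0 -> f (a + a) = 2%:R * f a.
  move=> ka; have := @fE a (a + a).
  have /detZ_neq0l a3 : det (a + (a + a) + k) a != 0.
    by rewrite !detZDl detZnn !add0r.
  move=> /(_ a3); rewrite !detZDl !detZDr detZnn [det a k]detZN => e.
  by apply: eq_cancel ka e _; ring.
have dblk a : det k a != 0 -> f (a + (a + k)) = - (2%:R * f (a + k)).
  move=> ka; have := @fE a (a + k).
  have /detZ_neq0l a2k : det (a + (a + k) + k) a != 0.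
    by rewrite !detZDl detZnn !add0r -mulr2n mulrn_eq0.
  move=> /(_ a2k); rewrite !detZDl !detZDr !detZnn [det a k]detZN => e.
  by apply: eq_cancel ka e _; ring.
(* For the pair (-a, -(a+k)) the coefficient of f(-(a+k)) vanishes, because -(a+k)+k = -a. This
   gives f(2a+k) = -2 f(a), to compare with [dblk]. *)
have shift a : det k a != 0 -> f (a + k) = f a.
  move=> ka; have := @fE (- a) (- (a + k)).
  have ka' : det k (a + k) != 0 by rewrite detZDr detZnn addr0.
  have ka2 : det k (a + (a + k)) != 0.
    by rewrite !detZDr detZnn addr0 -mulr2n mulrn_eq0.
  have /detZ_neq0l a2 : det (- a + - (a + k) + k) k != 0.
    by rewrite -opprD detZDl detZnn addr0 detZNl oppr_eq0 detZN oppr_eq0.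
  move=> /(_ a2); rewrite -opprD !opp // dblk //.
  rewrite !(detZDl, detZDr, detZNl, detZNr) !detZnn [det a k]detZN => e.
  have c0 : 2%:R * det k a != 0 by rewrite mulf_neq0.
  by apply: eq_cancel c0 e _; ring.
move=> km; have km2 : det k (m + m) != 0.
  by rewrite detZDr -mulr2n mulrn_eq0.
have := dblk _ km; rewrite addrA !shift // dbl // => e.
have c0 : 4%:R != 0 :> K by rewrite pnatr_eq0.
by apply: eq_cancel c0 e _; ring.
Qed.

Lemma even_vanish m : m != 0 -> m + k != 0 -> f m = 0.
Proof.
move=> m0 mk0; have [k0|k0] := eqVneq k 0; first exact: degree0_vanish.
have [km|] := eqVneq (det k m) 0; last exact: nonparallel_vanish.
(* When m is parallel to k, neither v nor m-v is, so f vanishes at both; their bracket is a nonzero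
   multiple of L_m. *)
pose v := rot90 k; have kv : det k v != 0 by exact: detZ_rot90.
have mv : det m v != 0 by exact: detZ_rot90_parallel.
have := @fE (m - v) v; rewrite subrK => /(_ mk0).
rewrite [f v]nonparallel_vanish // [f (m - v)]nonparallel_vanish; last first.
  by rewrite detZDr km detZNr add0r oppr_eq0.
rewrite !mulr0 addr0 oppr0 => /eqP.
by rewrite mulf_eq0 detZN detZDl detZNl detZnn oppr0 addr0 oppr_eq0 (negPf mv) => /eqP.
Qed.

End EvenPart.

(** * Coordinates of brackets *)

Section Coefficients.
Context {K : numFieldType}.
Implicit Types (s t : bool) (m n p q k : int * int).
Local Notation V := (kantor_carrier K).

(* The junk value at q = 0 matches the conventions L_0 = G_0 = 0. *)
Definition kcoeff s q (x : V) : K^o :=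
  if insub q is Some k then mcoeff (s, k) x else 0.

Lemma kcoeff_linear s q : linear (kcoeff s q).
Proof.
move=> a x y; rewrite /kcoeff; case: insub => [k|]; last first.
  by rewrite scaler0 addr0.
by rewrite mcoeffD mcoeffZ.
Qed.

Lemma kcoeffZ s q a x : kcoeff s q (a *: x) = a * kcoeff s q x.
Proof.
rewrite /kcoeff; case: insub => [k|]; last by rewrite mulr0.
by rewrite mcoeffZ.
Qed.

Lemma kcoeff0l s x : kcoeff s 0 x = 0.
Proof. by rewrite /kcoeff insubF ?eqxx. Qed.

Lemma kcoeff0r s q : kcoeff s q 0 = 0.
Proof. by rewrite -[0](scale0r 0) kcoeffZ mul0r. Qed.

Lemma kcoeff_kvec s q m : q != 0 -> kcoeff s q (kvec K s m) = (m == q)%:R.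
Proof.
move=> q0; have [->|m0] := eqVneq m 0.
  by rewrite kvec0 kcoeff0r eq_sym (negPf q0).
rewrite kvecE /kcoeff insubT mcoeffU; congr (_%:R : K).
by rewrite xpair_eqE eqxx -val_eqE.
Qed.

Lemma homog_kcoeff0 s x : khomog s x ->
  (forall q, q != 0 -> kcoeff s q x = 0) -> x = 0.
Proof.
move=> hx h; apply/malgP => -[t k]; rewrite mcoeff0.
have [->|ts] := eqVneq t s; last exact: hx.
by have := h _ (valP k); rewrite /kcoeff valK.
Qed.

(** By linearity [x] may be a basis vector; only its component of degree p-n reaches degree p. *)
Lemma kcoeff_kbracket_r s t x n p : khomog s x -> p != 0 ->
  kcoeff (s (+) t) p (kbracket x (kvec K t n)) =
  kcoef K s t (p - n) n * kcoeff s (p - n) x.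
Proof.
move=> hx p0; move: x hx; apply: (@khomog_ext K s K^o).
- exact: (linear_comp (kcoeff_linear _ _) (kbracket_linear_l _)).
- exact: (linear_scale _ (kcoeff_linear _ _)).
move=> m m0; rewrite kbracket_kcoef kcoeffZ kcoeff_kvec //.
(* At p = n the right side is the default 0, and the left side is 0 since m+n = n would force m =
   0. *)
have [pn0|pn0] := eqVneq (p - n) 0.
  rewrite pn0 kcoeff0l mulr0; have -> : p = n by apply/eqP; rewrite -subr_eq0 pn0.
  by rewrite -subr_eq0 addrK (negPf m0) mulr0.
rewrite kcoeff_kvec // eq_sym -subr_eq eq_sym.
by have [->|_] := eqVneq m (p - n); rewrite ?mulr0.
Qed.

Lemma kcoeff_kbracket_l s t m y p : khomog t y -> p != 0 ->
  kcoeff (s (+) t) p (kbracket (kvec K s m) y) =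
  kcoef K s t m (p - m) * kcoeff t (p - m) y.
Proof.
move=> hy p0; move: y hy; apply: (@khomog_ext K t K^o).
- exact: (linear_comp (kcoeff_linear _ _) (kbracket_linear_r _)).
- exact: (linear_scale _ (kcoeff_linear _ _)).
move=> n n0; rewrite kbracket_kcoef kcoeffZ kcoeff_kvec //.
have [pm0|pm0] := eqVneq (p - m) 0.
  rewrite pm0 kcoeff0l mulr0; have -> : p = m by apply/eqP; rewrite -subr_eq0 pm0.
  by rewrite -subr_eq0 addrAC subrr add0r (negPf n0) mulr0.
rewrite kcoeff_kvec // eq_sym addrC -subr_eq eq_sym.
by have [->|_] := eqVneq n (p - m); rewrite ?mulr0.
Qed.

End Coefficients.

(** * Vanishing of an even (-1)-superderivation *)

Section EvenSuperderivation.
Context {K : numFieldType} (D : kantor_carrier K -> kantor_carrier K).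
Hypothesis D_der : even_superderivation (kantor_virasoro K) (-1) D.
Implicit Types (s t : bool) (m n k : int * int).

Let D_linear : linear D. Proof. by case: D_der. Qed.

Let D_homog s x : khomog s x -> khomog s (D x).
Proof. by case: D_der => _ h _ /h. Qed.

Let D0 : D 0 = 0.
Proof. by have := D_linear (-1) 0 0; rewrite scaler0 add0r scaleN1r addNr. Qed.

Let DZ (a : K) x : D (a *: x) = a *: D x.
Proof. by have := D_linear a x 0; rewrite D0 !addr0. Qed.

(** For fixed [k], [c false k] is f and [c true k] is g in the part of degree k. *)
Let c s k m : K := kcoeff s (m + k) (D (kvec K s m)).

Lemma superder_coeffE s t k m n : m + n + k != 0 ->
  kcoef K s t m n * c (s (+) t) k (m + n) =
  - (kcoef K s t (m + k) n * c s k m + kcoef K s t m (n + k) * c t k n).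
Proof.
move=> p0; have hs := D_homog (@khomog_kvec K s m).
have ht := D_homog (@khomog_kvec K t n).
case: D_der => _ _ /(_ s t _ _ (@khomog_kvec K s m) (@khomog_kvec K t n)).
rewrite /= expr0 scale1r scaleN1r kbracket_kcoef DZ.
move=> /(congr1 (kcoeff (s (+) t) (m + n + k))); rewrite kcoeffZ => ->.
rewrite -scaleN1r kcoeffZ mulN1r -[kbracket (D _) _]scale1r kcoeff_linear.
rewrite scale1r kcoeff_kbracket_r // kcoeff_kbracket_l //.
have -> : m + n + k - n = m + k by rewrite addrAC addrK.
by have -> : m + n + k - m = n + k by rewrite -[m + n + k]addrA [m + (n + k)]addrC addrK.
Qed.

Lemma superder_even_coeff0 k m : m != 0 -> m + k != 0 -> c false k m = 0.
Proof. by apply: even_vanish => a b; apply: (@superder_coeffE false false). Qed.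

Lemma superder_odd_coeffE k m n : m != 0 -> n != 0 -> m + k != 0 ->
  n + k != 0 -> m + n + k != 0 -> c true k m + c true k n = 0.
Proof.
move=> m0 n0 mk0 nk0 mnk0; have := superder_coeffE true true mnk0.
rewrite /kcoef /= m0 n0 mk0 nk0 !mul1r => e.
apply: oppr_inj; rewrite -e oppr0.
(* For m+n = 0 the even coefficient is zero by the convention L_0 = 0. *)
have [->|mn0] := eqVneq (m + n) 0; last exact: superder_even_coeff0.
by rewrite /c kvec0 D0 kcoeff0r.
Qed.

(** The pair (m,m) gives 2 g(m) = 0 unless 2m+k = 0. In that case k = -2m, the doubling argument
    applies to -m because -2m+k = -4m, and the pair (m,-m) carries the vanishing over to m. *)
Lemma superder_odd_coeff0 k m : m != 0 -> m + k != 0 -> c true k m = 0.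
Proof.
move=> m0 mk0.
have dbl n : n != 0 -> n + k != 0 -> n + n + k != 0 -> c true k n = 0.
  move=> n0 nk0 nnk0; have /eqP := superder_odd_coeffE n0 n0 nk0 nk0 nnk0.
  by rewrite -mulr2n mulrn_eq0 => /eqP.
have [mmk|] := eqVneq (m + m + k) 0; last exact: dbl.
have kE : k = - (m *+ 2) by apply/eqP; rewrite -addr_eq0 addrC mulr2n mmk.
have n0 : - m != 0 by rewrite oppr_eq0.
have nk : - m + k = - (m *+ 3) by rewrite kE -opprD -mulrS.
have nk0 : - m + k != 0 by rewrite nk oppr_eq0 lattice_mulrn_eq0.
have mnk0 : m + - m + k != 0.
  by rewrite subrr add0r kE oppr_eq0 lattice_mulrn_eq0.
have nnk0 : - m + - m + k != 0.
  by rewrite -addrA nk -opprD -mulrS oppr_eq0 lattice_mulrn_eq0.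
have := superder_odd_coeffE m0 n0 mk0 nk0 mnk0.
by rewrite (dbl _ n0 nk0 nnk0) addr0.
Qed.

Lemma superder_eq0 x : D x = 0.
Proof.
have Dk s m : D (kvec K s m) = 0.
  have [->|m0] := eqVneq m 0; first by rewrite kvec0 D0.
  apply: (homog_kcoeff0 (D_homog (@khomog_kvec K s m))) => q q0.
  have qE : m + (q - m) = q by rewrite addrC subrK.
  have := q0; rewrite -qE => mq0.
  by case: s; [apply: superder_odd_coeff0 | apply: superder_even_coeff0].
rewrite [x]malg_lext /lext Defs.linear_sum // big1 // => -[s k] _.
by rewrite -kvec_val Dk scaler0.
Qed.

End EvenSuperderivation.

Theorem theorem4p6 (R : realType) :
  even_superderivation (kantor_virasoro R[i]) (-1) = [set \0].
Proof.
apply/seteqP; split=> [D D_der | _ ->].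
  by apply/funext => x; apply: superder_eq0.
split=> [a x y|s x _|s t x y _ _] /=; rewrite ?scaler0 ?addr0 //.
- exact: khomog0.
- by rewrite kbracket0l kbracket0r scaler0 addr0 scaler0.
Qed.
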